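(* Let $P_1$ be the Cantor distribution satisfying $P_1=\frac12P_1\circ S_1^{-1}+\frac12P_1\circ S_2^{-1}$ with $S_1(x)=\frac13x$, $S_2(x)=\frac13x+\frac29$, let $P_2$ be the Cantor distribution satisfying $P_2=\frac12P_2\circ T_1^{-1}+\frac12P_2\circ T_2^{-1}$ with $T_1(x)=\frac14x+\frac12$, $T_2(x)=\frac14x+\frac34$, and let $P=\frac12P_1+\frac12P_2$. Then the quantization dimension $D(P)$ of $P$ exists and $D(P)=\max\{D(P_1),D(P_2)\}$.
   Context: $P_1$ and $P_2$ are the unique Borel probability measures on $\mathbb R$ satisfying the stated self-similarity relations. For a Borel probability measure $Q$ on $\mathbb R$ with finite second moment, the $n$th quantization error is $V_n(Q)=\inf\{\int\min_{a\in\alpha}(x-a)^2\,dQ(x):\alpha\subset\mathbb R,\ 1\le\mathrm{card}(\alpha)\le n\}$. The quantization dimension of $Q$ is $D(Q)=\lim_{n\to\infty}\frac{2\log n}{-\log V_n(Q)}$, when this limit exists. It is known that $D(P_1)=\frac{\log2}{\log3}$ and $D(P_2)=\frac12$ (the Hausdorff dimensions of the respective Cantor sets). *)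

(* Defs.v *)
From mathcomp Require Import all_boot all_order all_algebra finmap.
From mathcomp Require Import all_classical all_reals all_analysis.

Set Implicit Arguments.
Unset Strict Implicit.
Unset Printing Implicit Defensive.

Import Order.TTheory GRing.Theory Num.Theory.
Import numFieldNormedType.Exports.

Local Open Scope classical_set_scope.
Local Open Scope ring_scope.

Definition is_half_mixture (R : realType)
    (Q Q1 Q2 : set (measurableTypeR R) -> \bar R) : Prop :=
  forall A : set (measurableTypeR R), measurable A ->
    (Q A = (2^-1)%:E * Q1 A + (2^-1)%:E * Q2 A)%E.

Definition is_self_similar (R : realType)
    (Q : set (measurableTypeR R) -> \bar R)
    (S1 S2 : measurableTypeR R -> measurableTypeR R) : Prop :=
  is_half_mixture Q (pushforward Q S1) (pushforward Q S2).

(* The index +oo is neutral for the minimum, so that for nonempty alpha the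
   integrand is exactly the minimum of (x - a)^2 over a in alpha. *)
Definition distortion (R : realType) (Q : probability (measurableTypeR R) R)
    (alpha : {fset R}) : \bar R :=
  (\int[Q]_x \big[Order.min/+oo]_(a <- alpha) (((x : R) - a) ^+ 2)%:E)%E.

(* When Q has a finite second moment and n > 0 the infimum is finite, so that
   fine loses nothing. *)
Definition quantization_error (R : realType)
    (Q : probability (measurableTypeR R) R) (n : nat) : R :=
  fine (ereal_inf [set distortion Q alpha | alpha in
                    [set alpha : {fset R} | (1 <= #|` alpha| <= n)%N]]).

Definition quantization_ratio (R : realType)
    (Q : probability (measurableTypeR R) R) (n : nat) : R :=
  2 * ln n%:R / - ln (quantization_error Q n).

Definition has_quantization_dim (R : realType)
    (Q : probability (measurableTypeR R) R) : Prop :=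
  cvgn (quantization_ratio Q).

(* Meaningful only under has_quantization_dim Q. *)
Definition quantization_dim (R : realType)
    (Q : probability (measurableTypeR R) R) : R :=
  limn (quantization_ratio Q).

(* Main.v *)
(* For an iterated function system of two maps s x + b1 and s x + b2 with
   s < 1/2, the level-k images of the support give 2^k points covering Q at
   radius O(s^k), while every ball of radius rho s^k carries mass at most 2^-k,
   because s < 1/2 separates the images of the support. So 2^(k+1) points leave
   a fixed mass at distance at least a constant times s^k, whence V_n is
   comparable to s^(2k) for n about 2^k, and D(Q) = ln 2 / - ln s.  For the half
   mixture, the lower bound is inherited from P1 and the upper bound from the
   union of near-optimal sets for P1 and P2, both at scale 3^-k. *)

Require Import Defs.
From mathcomp Require Import all_boot all_order all_algebra finmap.
From mathcomp Require Import all_classical all_reals all_analysis.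
From mathcomp Require Import measurable_realfun ring lra.
Import Order.TTheory GRing.Theory Num.Theory.
Import numFieldNormedType.Exports.
Local Open Scope classical_set_scope.
Local Open Scope ring_scope.

Set Implicit Arguments.
Unset Strict Implicit.

(** * Real-valued probabilities, affine preimages and finite unions of balls *)

Section prob.
Context (R : realType).
Implicit Types (Q : probability (measurableTypeR R) R) (al : {fset R}).

(** Real values let [lra] and [field] handle masses; on measurable sets [fine] loses nothing, as [Q]
    is finite. *)
Definition prob Q (A : set (measurableTypeR R)) : R := fine (Q A).

Lemma probK Q A : measurable A -> Q A = (prob Q A)%:E.
Proof. by move=> mA; rewrite fineK// fin_num_measure. Qed.

Lemma prob_ge0 Q A : 0 <= prob Q A.
Proof. exact/fine_ge0/measure_ge0. Qed.

Lemma prob_le1 Q A : measurable A -> prob Q A <= 1.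
Proof. by move=> mA; rewrite -lee_fin -probK// probability_le1. Qed.

Lemma prob_setC Q A : measurable A -> prob Q (~` A) = 1 - prob Q A.
Proof.
move=> mA; apply: EFin_inj; rewrite -probK; last exact: measurableC.
by rewrite probability_setC// EFinB -probK.
Qed.

Lemma le_prob Q A B : measurable A -> measurable B -> A `<=` B ->
  prob Q A <= prob Q B.
Proof.
by move=> mA mB AB; rewrite -lee_fin -!probK// le_measure// inE.
Qed.

Lemma prob_half_mixture Q Q1 Q2 A : is_half_mixture Q Q1 Q2 -> measurable A ->
  prob Q A = 2^-1 * prob Q1 A + 2^-1 * prob Q2 A.
Proof.
by move=> h mA; apply: EFin_inj; rewrite EFinD !EFinM -!probK// h.
Qed.

Definition affine (s b : R) (x : measurableTypeR R) : measurableTypeR R :=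
  s * x + b.

Lemma measurable_affine_preimage s b A :
  measurable A -> measurable (affine s b @^-1` A).
Proof.
move=> mA; rewrite -[X in measurable X]setTI.
have : measurable_fun setT (affine s b).
  by apply: measurable_funD => //; apply: measurable_funM.
by apply.
Qed.

Lemma prob_self_similar Q s b1 b2 A :
  is_self_similar Q (affine s b1) (affine s b2) -> measurable A ->
  prob Q A = 2^-1 * prob Q (affine s b1 @^-1` A)
           + 2^-1 * prob Q (affine s b2 @^-1` A).
Proof.
move=> h mA; apply: EFin_inj; rewrite EFinD !EFinM -!probK//.
- exact: h.
- exact: measurable_affine_preimage.
- exact: measurable_affine_preimage.
Qed.

Definition cball (a r : R) : set (measurableTypeR R) :=
  [set x : R | `|x - a| <= r].

Lemma measurable_cball a r : measurable (cball a r).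
Proof.
have -> : cball a r = `[a - r, a + r]%classic.
  by apply/seteqP; split => x /=; rewrite /cball/= in_itv/= ler_distl.
exact: measurable_itv.
Qed.

Definition nbhd (al : {fset R}) (r : R) : set (measurableTypeR R) :=
  \big[setU/set0]_(a <- al) cball a r.

Lemma measurable_nbhd al r : measurable (nbhd al r).
Proof. by apply: bigsetU_measurable => a _; exact: measurable_cball. Qed.

Lemma nbhdP al r x : nbhd al r x <-> exists2 a, a \in al & `|x - a| <= r.
Proof. by rewrite /nbhd -bigcup_fset; split. Qed.

Lemma prob_nbhd_le Q al r p : (forall a, prob Q (cball a r) <= p) ->
  prob Q (nbhd al r) <= #|` al|%:R * p.
Proof.
move=> h; rewrite /nbhd; elim: (al : seq R) => [|a l IH].
  by rewrite big_nil mul0r /prob measure0.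
have mU : measurable (\big[setU/set0]_(j <- l) cball j r).
  by apply: bigsetU_measurable => b _; exact: measurable_cball.
rewrite big_cons /= -natr1 mulrDl mul1r addrC.
apply: le_trans (lerD (h a) IH).
rewrite -lee_fin EFinD -!probK//; last 2 first.
- exact: measurable_cball.
- by apply: measurableU => //; exact: measurable_cball.
by apply: measureU2 => //; exact: measurable_cball.
Qed.

(** Continuity from below along the balls of integer radius. It supplies a starting ball for the
    contraction argument that locates the support. *)
Lemma prob_cball_cvg1 Q c e : 0 < e -> exists N : nat, 1 - e <= prob Q (cball c N%:R).
Proof.
move=> e0.
have U : \bigcup_n cball c n%:R = setT.
  apply/seteqP; split => // x _.
  exists (Num.truncn `|x - c|).+1 => //=.
  by rewrite /cball/= ltW// truncnS_gt.
have mF (n : nat) : measurable (cball c n%:R) by exact: measurable_cball.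
have hm : {homo (fun n : nat => cball c n%:R) : n m / (n <= m)%N >-> (n <= m)%O}.
  move=> n m nm; apply/subsetPset => x; rewrite /cball/= => /le_trans; apply.
  by rewrite ler_nat.
have : (Q (cball c n%:R)) @[n --> \oo] --> 1%E.
  have <- : Q (\bigcup_n cball c n%:R) = 1%E by rewrite U probability_setT.
  by apply: nondecreasing_cvg_mu => //; rewrite U.
move=> /fine_cvgP[_].
move=> /cvgr_dist_le /(_ e e0)[N _ /(_ N (leqnn _))] /=.
move=> /ler_normlW; rewrite /prob => ?; exists N; lra.
Qed.

End prob.

(** * Support, coverings and ball masses of a self-similar measure *)

Section self_similar.
Context (R : realType).
Implicit Types (Q : probability (measurableTypeR R) R) (al : {fset R}).

(* The two maps contract [|x - c|] by the factor [s] up to the additive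
   constant [(b2 - b1) / 2], whose accumulated effect is [M0]. *)
Lemma self_similar_support Q (s b1 b2 M : R) :
    is_self_similar Q (affine s b1) (affine s b2) ->
    0 < s < 1 -> b1 <= b2 -> (b2 - b1) / (2 * (1 - s)) < M ->
  prob Q (cball ((b1 + b2) / (2 * (1 - s))) M) = 1.
Proof.
move=> ss /andP[s0 s1] b12 M0M.
(* The fixed points of the two maps are [b1 / (1 - s)] and [b2 / (1 - s)]; [c] is their midpoint and
   [M0] half their distance. *)
set c := (b1 + b2) / _; set M0 := (b2 - b1) / _ in M0M.
have s10 : 1 - s != 0 by rewrite subr_eq0 gt_eqF.
have cE : (1 - s) * c = (b1 + b2) / 2 by rewrite /c; field.
have M0E : (1 - s) * M0 = (b2 - b1) / 2 by rewrite /M0; field.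
have contr b x r : b1 <= b <= b2 -> `|x - c| <= r ->
    `|affine s b x - c| <= s * r + (1 - s) * M0.
  move=> /andP[b1b bb2] xr.
  have -> : affine s b x - c = s * (x - c) + (b - (1 - s) * c).
    by rewrite /affine; ring.
  apply: (le_trans (ler_normD _ _)); apply: lerD.
    by rewrite normrM (gtr0_norm s0) ler_wpM2l// ltW.
  by rewrite cE M0E ler_norml; apply/andP; split; lra.
(* Since [s * (M0 + t) + (1 - s) * M0 = M0 + s * t], both maps send the larger ball into the smaller
   one, so each preimage in the self-similarity relation contains the larger ball. *)
have step t : prob Q (cball c (M0 + t)) <= prob Q (cball c (M0 + s * t)).
  have sub b : b1 <= b <= b2 ->
      cball c (M0 + t) `<=` affine s b @^-1` cball c (M0 + s * t).
    move=> bb x /(contr b _ _ bb); rewrite /cball/= => /le_trans; apply.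
    by rewrite le_eqVlt; apply/orP; left; apply/eqP; ring.
  rewrite [leRHS](prob_self_similar ss); last exact: measurable_cball.
  have le b : b1 <= b <= b2 -> prob Q (cball c (M0 + t)) <=
      prob Q (affine s b @^-1` cball c (M0 + s * t)).
    move=> bb; apply: le_prob; [exact: measurable_cball| |exact: sub].
    by apply: measurable_affine_preimage; exact: measurable_cball.
  have := le b1; have := le b2; rewrite b12 !lexx => /(_ isT) ? /(_ isT) ?; lra.
have steps n t : prob Q (cball c (M0 + t)) <= prob Q (cball c (M0 + s ^+ n * t)).
  elim: n => [|n IH]; first by rewrite expr0 mul1r.
  by apply: (le_trans IH); rewrite exprS -mulrA; exact: step.
apply/eqP; rewrite eq_le prob_le1 /=; last exact: measurable_cball.
(* Start from a ball of mass at least [1 - e] and shrink the excess radius [N] by powers of [s]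
   until it fits into [M - M0]; no mass is lost on the way. *)
apply/ler_addgt0Pr => e e0.
have [N hN] := prob_cball_cvg1 Q c e0.
rewrite -lerBlDr; apply: (le_trans hN).
have d0 : 0 < M - M0 by rewrite subr_gt0.
have [n hn] : exists n, s ^+ n * N%:R <= M - M0.
  have : (fun n => s ^+ n * N%:R) @ \oo --> (0 : R).
    rewrite -[X in _ --> X](mul0r (N%:R : R)); apply: cvgM; last exact: cvg_cst.
    by apply: cvg_expr; rewrite gtr0_norm.
  move=> /cvgr_dist_le /(_ _ d0)[n _ /(_ n (leqnn n))] /=.
  by rewrite sub0r normrN => /ler_normlW ?; exists n.
have M00 : 0 <= M0 by apply: divr_ge0; lra.
apply: (@le_trans _ _ (prob Q (cball c (M0 + N%:R)))).
  apply: le_prob; [exact: measurable_cball|exact: measurable_cball|].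
  by move=> x; rewrite /cball/= => /le_trans; apply; rewrite lerDr.
apply: (le_trans (steps n _)).
apply: le_prob; [exact: measurable_cball|exact: measurable_cball|].
by move=> x; rewrite /cball/= => /le_trans; apply; lra.
Qed.

(** The centres are the images of [c] under all words of length [k] in the two maps. Each level at
    most doubles their number and scales the radius by [s]. *)
Lemma self_similar_cover Q (s b1 b2 c M : R) :
    is_self_similar Q (affine s b1) (affine s b2) -> 0 <= s ->
    prob Q (cball c M) = 1 ->
  forall k, exists2 al, (0 < #|` al| <= 2 ^ k)%N & prob Q (nbhd al (s ^+ k * M)) = 1.
Proof.
move=> ss s0 h; elim=> [|k [al /andP[al0 alk] IH]].
  exists [fset c]%fset; first by rewrite cardfs1.
  by rewrite /nbhd big_seq_fset1 expr0 mul1r.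
exists ([fset affine s b1 x | x in al] `|` [fset affine s b2 x | x in al])%fset.
  rewrite cardfsU.
  have card_le b : (#|` [fset affine s b x | x in al]%fset| <= 2 ^ k)%N.
    by apply: leq_trans alk; exact: leq_imfset_card.
  apply/andP; split.
    rewrite -cardfsU cardfs_gt0.
    move: al0; rewrite cardfs_gt0 => /fset0Pn[x xal].
    by apply/fset0Pn; exists (affine s b1 x); rewrite in_fsetU in_imfset.
  rewrite expnS mul2n -addnn.
  by apply: (leq_trans (leq_subr _ _)); apply: leq_add.
set al' := (_ `|` _)%fset.
apply/eqP; rewrite eq_le prob_le1 /=; last exact: measurable_nbhd.
rewrite (prob_self_similar ss); last exact: measurable_nbhd.
(* Pulling the new neighbourhood back along either map recovers at least the old one, which already
   has full mass. *)
have le b : (forall x, x \in al -> affine s b x \in al') ->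
    1 <= prob Q (affine s b @^-1` nbhd al' (s ^+ k.+1 * M)).
  move=> hb; rewrite -IH; apply: le_prob.
  - exact: measurable_nbhd.
  - by apply: measurable_affine_preimage; exact: measurable_nbhd.
  move=> x /nbhdP[a aal xa]; apply/nbhdP; exists (affine s b a); first exact: hb.
  have -> : affine s b x - affine s b a = s * (x - a) by rewrite /affine; ring.
  by rewrite normrM (ger0_norm s0) exprS -mulrA ler_wpM2l.
rewrite -[leLHS](_ : 2^-1 * 1 + 2^-1 * 1 = 1); last by field.
apply: lerD; rewrite ler_pM2l ?invr_gt0 ?ltr0n//.
- by apply: le => x xal; rewrite in_fsetU in_imfset.
- by apply: le => x xal; rewrite in_fsetU [X in _ || X]in_imfset ?orbT.
Qed.

(* At most one of the two preimages of a small ball meets the support of [Q],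
   so shrinking the radius by [s] at least halves the mass. *)
Lemma self_similar_cball_le Q (s b1 b2 c M rho : R) :
    is_self_similar Q (affine s b1) (affine s b2) -> 0 < s <= 1 -> 0 <= rho ->
    prob Q (cball c M) = 1 -> 2 * (rho + M) < (b2 - b1) / s ->
  forall k a, prob Q (cball a (s ^+ k * rho)) <= 2^-1 ^+ k.
Proof.
move=> ss /andP[s0 s1] rho0 h sep; elim=> [|k IH] a.
  by rewrite expr0 prob_le1//; exact: measurable_cball.
rewrite (prob_self_similar ss); last exact: measurable_cball.
have pre b : affine s b @^-1` cball a (s ^+ k.+1 * rho) =
    cball ((a - b) / s) (s ^+ k * rho).
  apply/funext => x; rewrite /cball/preimage/=.
  rewrite (_ : affine s b x - a = s * (x - (a - b) / s)); last first.
    by rewrite /affine; field; rewrite gt_eqF.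
  by rewrite normrM (gtr0_norm s0) exprS -mulrA ler_pM2l.
rewrite !pre.
(* Such a ball is disjoint from [cball c M], which carries all the mass. *)
have out z : s ^+ k * rho + M < `|z - c| -> prob Q (cball z (s ^+ k * rho)) = 0.
  move=> hz; apply/eqP; rewrite eq_le prob_ge0 andbT.
  have : prob Q (~` cball c M) = 0.
    by rewrite prob_setC ?h ?subrr//; exact: measurable_cball.
  move=> <-; apply: le_prob; first exact: measurable_cball.
    by apply: measurableC; exact: measurable_cball.
  move=> x; rewrite /cball/= => xz xc; move: hz; apply/negP; rewrite -leNgt.
  rewrite (_ : z - c = (z - x) + (x - c)); last by ring.
  by apply: (le_trans (ler_normD _ _)); rewrite lerD// distrC.
have sk : s ^+ k * rho <= rho.
  by rewrite ler_piMl// exprn_ile1// ltW.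
(* The two preimage centres are [(b2 - b1) / s] apart, so by [sep] they cannot both lie close to
   [c]. *)
have far : s ^+ k * rho + M < `|(a - b1) / s - c| \/
           s ^+ k * rho + M < `|(a - b2) / s - c|.
  case: (ltP (s ^+ k * rho + M) `|(a - b1) / s - c|) => h1; first by left.
  right; rewrite ltNge; apply/negP => h2.
  have : (b2 - b1) / s <= 2 * (s ^+ k * rho + M).
    rewrite (_ : (b2 - b1) / s = ((a - b1) / s - c) - ((a - b2) / s - c)); last first.
      by field; rewrite gt_eqF.
    apply: (le_trans (ler_norm _)); apply: (le_trans (ler_normB _ _)); lra.
  by lra.
rewrite exprS.
by case: far => /out ->; rewrite mulr0 ?add0r ?addr0 ler_pM2l ?invr_gt0 ?ltr0n.
Qed.

End self_similar.

(** * Distortion bounds, and covering and spreading at geometric scales *)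

Section quantization.
Context (R : realType).
Implicit Types (Q : probability (measurableTypeR R) R) (al : {fset R}).

Lemma measurable_min_dist (l : seq R) :
  measurable_fun setT (fun x : measurableTypeR R =>
    \big[Order.min/+oo%E]_(a <- l) (((x : R) - a) ^+ 2)%:E).
Proof.
elim: l => [|a l IH]; first by under eq_fun do rewrite big_nil; exact: measurable_cst.
under eq_fun do rewrite big_cons.
apply: measurable_mine => //; apply/measurable_EFinP.
by apply: measurable_funX; apply: measurable_funB.
Qed.

Lemma min_dist_ge (l : seq R) (x : R) (z : \bar R) :
  (forall a, a \in l -> (z <= ((x - a) ^+ 2)%:E)%E) ->
  (z <= \big[Order.min/+oo%E]_(a <- l) ((x - a) ^+ 2)%:E)%E.
Proof.
elim: l => [|a l IH] h; first by rewrite big_nil leey.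
rewrite big_cons le_min h ?mem_head//= IH// => b bl.
by rewrite h// in_cons bl orbT.
Qed.

Lemma min_dist_le (l : seq R) (x a : R) : a \in l ->
  (\big[Order.min/+oo%E]_(b <- l) ((x - b) ^+ 2)%:E <= ((x - a) ^+ 2)%:E)%E.
Proof.
elim: l => [//|b l IH]; rewrite in_cons big_cons ge_min => /orP[/eqP->|/IH->].
  by rewrite lexx.
by rewrite orbT.
Qed.

Lemma min_dist_ge0 (l : seq R) (x : R) :
  (0 <= \big[Order.min/+oo%E]_(a <- l) ((x - a) ^+ 2)%:E)%E.
Proof. by apply: min_dist_ge => a _; rewrite lee_fin sqr_ge0. Qed.

(** A Markov-type bound: outside the neighbourhood the integrand is at least [r ^+ 2]. *)
Lemma distortion_ge Q al r p : 0 <= r -> p <= prob Q (~` nbhd al r) ->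
  ((r ^+ 2 * p)%:E <= distortion Q al)%E.
Proof.
move=> r0 hp.
have mN : measurable (~` nbhd al r) by apply: measurableC; exact: measurable_nbhd.
apply: (@le_trans _ _ (\int[Q]_(x in ~` nbhd al r) (r ^+ 2)%:E)%E).
  rewrite (integral_cst Q mN) /= (probK Q mN) -EFinM lee_fin.
  by rewrite ler_wpM2l// sqr_ge0.
apply: (@le_trans _ _ (\int[Q]_(x in ~` nbhd al r)
    \big[Order.min/+oo%E]_(a <- al) (((x : R) - a) ^+ 2)%:E)%E).
  apply: ge0_le_integral => //.
  - by move=> x _; rewrite lee_fin sqr_ge0.
  - by apply: measurable_funTS; exact: measurable_min_dist.
  move=> x xN; apply: min_dist_ge => a aal; rewrite lee_fin.
  rewrite -[leRHS]real_normK ?num_real// ler_sqr ?nnegrE//.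
  rewrite leNgt; apply/negP => xa; apply: xN; apply/nbhdP.
  by exists a => //; exact: ltW.
apply: ge0_subset_integral => //.
- exact: measurable_min_dist.
- by move=> x _; exact: min_dist_ge0.
Qed.

(** The complement of the neighbourhood is negligible, and on the neighbourhood the integrand is at
    most [r ^+ 2]. *)
Lemma distortion_le Q al r : prob Q (nbhd al r) = 1 ->
  (distortion Q al <= (r ^+ 2)%:E)%E.
Proof.
move=> h.
have mN := @measurable_nbhd R al r.
have QN : Q (~` nbhd al r) = 0%E.
  by rewrite probK ?prob_setC ?h ?subrr//; exact: measurableC.
rewrite /distortion (ge0_negligible_integral (measurableC mN) measurableT _ _ QN)//.
- rewrite setTD setCK.
  apply: (@le_trans _ _ (\int[Q]_(x in nbhd al r) (r ^+ 2)%:E)%E).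
    apply: ge0_le_integral => //.
    + by move=> x _; exact: min_dist_ge0.
    + by apply: measurable_funTS; exact: measurable_min_dist.
    move=> x /nbhdP[a aal xa]; apply: (le_trans (min_dist_le _ aal)).
    rewrite lee_fin -[leLHS]real_normK ?num_real//.
    by rewrite ler_sqr ?nnegrE// (le_trans _ xa).
  by rewrite (integral_cst Q mN) /= (probK Q mN) h mule1.
- exact: measurable_min_dist.
- by move=> x _; exact: min_dist_ge0.
Qed.

(** The two real bounds also force the infimum to be finite, which makes [fine] faithful here. *)
Lemma quantization_error_bounds Q n (lo hi : R) :
    (forall al, (#|` al| <= n)%N -> (lo%:E <= distortion Q al)%E) ->
    (exists2 al, (0 < #|` al| <= n)%N & (distortion Q al <= hi%:E)%E) ->
  lo <= quantization_error Q n <= hi.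
Proof.
move=> hlo [al aln hhi]; rewrite /quantization_error.
set V := ereal_inf _.
have loV : (lo%:E <= V)%E.
  by apply/ereal_infP => _ [b /andP[_ bn] <-]; exact: hlo.
have Vhi : (V <= hi%:E)%E.
  by apply: le_trans hhi; apply: ereal_inf_lbound; exists al.
have Vfin : V \is a fin_num.
  by rewrite fin_real// (lt_le_trans (ltNyr _) loV) (le_lt_trans Vhi (ltry _)).
by rewrite -!lee_fin fineK// loV Vhi.
Qed.

(** The upper-bound half of the scaling. The factor [m] leaves room for uniting the point sets of
    two measures. *)
Definition covers (m : nat) Q (s : R) := exists2 M, 0 < M & forall k,
  exists2 al, (0 < #|` al| <= m * 2 ^ k)%N & prob Q (nbhd al (s ^+ k * M)) = 1.

(** The lower-bound half: no set of [2 ^ k.+1] points comes within order [s ^+ k] of all but a mass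
    [p], uniformly in [k]. *)
Definition spreads Q (s : R) := exists2 rho, 0 < rho & exists2 p, 0 < p &
  forall k al, (#|` al| <= 2 ^ k.+1)%N ->
    p <= prob Q (~` nbhd al (s ^+ k * rho)).

Lemma self_similar_covers_spreads Q (s b1 b2 : R) :
    is_self_similar Q (affine s b1) (affine s b2) ->
    0 < s < 2^-1 -> b1 < b2 -> covers 1 Q s /\ spreads Q s.
Proof.
move=> ss /andP[s0 s12] b12.
have s1 : s < 1 by lra.
set w := b2 - b1.
have w0 : 0 < w by rewrite subr_gt0.
have lt : w / (2 * (1 - s)) < w / (2 * s).
  by rewrite ltr_pM2l// ltf_pV2 ?posrE; lra.
have M00 : 0 < w / (2 * (1 - s)) by rewrite divr_gt0//; lra.
(* [M] must exceed the half-width of the support yet stay below [w / (2 * s)] to separate the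
   preimages. The gap is nonempty because [s < 1 - s]. *)
have [M lM Mu] : exists2 M, w / (2 * (1 - s)) < M & M < w / (2 * s).
  by exists ((w / (2 * (1 - s)) + w / (2 * s)) / 2); lra.
have M0 : 0 < M by apply: lt_trans lM.
have supp : prob Q (cball ((b1 + b2) / (2 * (1 - s))) M) = 1.
  by apply: (self_similar_support ss) => //; [rewrite s0 s1|exact: ltW].
split.
  exists M => // k.
  by rewrite mul1n; exact: (self_similar_cover ss (ltW s0) supp k).
pose rho := (w / (2 * s) - M) / 2.
have rho0 : 0 < rho by rewrite /rho; lra.
(* The factor [s ^+ 2] moves to level [k.+2], where balls have mass at most [2^-1 ^+ k.+2]; then
   [2 ^ k.+1] of them carry at most one half. *)
exists (s ^+ 2 * rho); first by rewrite mulr_gt0// exprn_gt0.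
exists 2^-1; first by rewrite invr_gt0.
move=> k al alk; rewrite mulrA -exprD addn2.
rewrite prob_setC; last exact: measurable_nbhd.
have sep : 2 * (rho + M) < w / s.
  have -> : w / s = 2 * (w / (2 * s)) by field; rewrite gt_eqF.
  by rewrite /rho; lra.
have := prob_nbhd_le al (fun a => self_similar_cball_le ss _ (ltW rho0) supp sep k.+2 a).
rewrite s0 (ltW s1) => /(_ isT) h.
suff : #|` al|%:R * 2^-1 ^+ k.+2 <= 2^-1 :> R by lra.
have : #|` al|%:R <= 2 ^+ k.+1 :> R by rewrite -natrX ler_nat.
move=> /(ler_wpM2r (_ : 0 <= 2^-1 ^+ k.+2)) -/(_ _)/le_trans; apply.
  by rewrite exprn_ge0.
by rewrite [2^-1 ^+ k.+2]exprS mulrCA -exprMn divff// expr1n mulr1.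
Qed.

Lemma covers_half_mixture m Q Q1 Q2 s : is_half_mixture Q Q1 Q2 -> 0 <= s ->
  covers m Q1 s -> covers m Q2 s -> covers (2 * m) Q s.
Proof.
move=> hQ s0 [M1 M10 h1] [M2 M20 h2]; exists (Num.max M1 M2); first by rewrite lt_max M10.
move=> k; have [al1 /andP[al10 al1k] hal1] := h1 k.
have [al2 /andP[al20 al2k] hal2] := h2 k.
exists (al1 `|` al2)%fset.
  apply/andP; split.
    by apply: (leq_trans al10); apply: fsubset_leq_card; exact: fsubsetUl.
  rewrite cardfsU; apply: (leq_trans (leq_subr _ _)).
  by rewrite -mulnA mul2n -addnn leq_add.
set al := (al1 `|` al2)%fset; set r := s ^+ k * _.
have le1 (Q' : probability (measurableTypeR R) R) al' M' :
    (al' `<=` al)%fset -> M' <= Num.max M1 M2 ->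
    prob Q' (nbhd al' (s ^+ k * M')) = 1 -> prob Q' (nbhd al r) = 1.
  move=> /fsubsetP sub M'M hal; apply/eqP.
  rewrite eq_le prob_le1 /=; last exact: measurable_nbhd.
  rewrite -hal; apply: le_prob; [exact: measurable_nbhd|exact: measurable_nbhd|].
  move=> x /nbhdP[a aal xa]; apply/nbhdP; exists a; first exact: sub.
  by apply: (le_trans xa); rewrite ler_wpM2l// exprn_ge0.
rewrite (prob_half_mixture hQ); last exact: measurable_nbhd.
rewrite (le1 Q1 al1 M1) ?fsubsetUl ?le_max ?lexx//.
rewrite (le1 Q2 al2 M2) ?fsubsetUr ?le_max ?lexx ?orbT//.
by field.
Qed.

(** Half of the mass that [Q1] leaves uncovered is left uncovered by [Q]. *)
Lemma spreads_half_mixture Q Q1 Q2 s : is_half_mixture Q Q1 Q2 ->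
  spreads Q1 s -> spreads Q s.
Proof.
move=> hQ [rho rho0 [p p0 h]]; exists rho => //; exists (2^-1 * p).
  by rewrite mulr_gt0// invr_gt0.
move=> k al alk; rewrite (prob_half_mixture hQ); last first.
  by apply: measurableC; exact: measurable_nbhd.
rewrite -[leLHS]addr0; apply: lerD; first by rewrite ler_pM2l ?invr_gt0// h.
by rewrite mulr_ge0// ?invr_ge0// prob_ge0.
Qed.

(** Balls only grow when [s] is replaced by [t]. This brings the measure with ratio 1/4 to the
    coarser scale of ratio 1/3. *)
Lemma covers_mono m m' Q s t : (m <= m')%N -> 0 <= s -> s <= t ->
  covers m Q s -> covers m' Q t.
Proof.
move=> mm' s0 st [M M0 h]; exists M => // k; have [al /andP[al0 alk] hal] := h k.
exists al; first by rewrite al0 (leq_trans alk)// leq_mul2r mm' orbT.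
 apply/eqP; rewrite eq_le prob_le1 /=; last exact: measurable_nbhd.
rewrite -hal; apply: le_prob; [exact: measurable_nbhd|exact: measurable_nbhd|].
move=> x /nbhdP[a aal xa]; apply/nbhdP; exists a => //.
apply: (le_trans xa); rewrite ler_pM2r//.
by rewrite lerXn2r// nnegrE// (le_trans s0).
Qed.

End quantization.

(** * From two-sided scaling to the limit of the quantization ratio *)

Section dimension.
Context (R : realType).
Implicit Types (Q : probability (measurableTypeR R) R).

Lemma near_ln_ge (y : R) : \forall n \near \oo, y <= ln n%:R :> R.
Proof.
exists (Num.truncn (expR y)).+1 => // n /= hn.
have yn : expR y <= n%:R.
  by apply: (le_trans (ltW (truncnS_gt _))); rewrite ler_nat.
by rewrite -[leLHS]expRK ler_ln ?posrE ?expR_gt0// (lt_le_trans (expR_gt0 y)).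
Qed.

(** Both [- ln (quantization_error Q n)] and the linear term in [ln n%:R] equal [2 * k%:R * - ln s]
    up to a bounded amount, where [n] is about [2 ^ k]. *)
Lemma ln_quantization_error_approx Q s : 0 < s < 1 -> covers 2 Q s -> spreads Q s ->
  exists B : R, forall n, (2 <= n)%N ->
    `|- ln (quantization_error Q n) - 2 * - ln s / ln 2 * ln n%:R| <= B.
Proof.
move=> /andP[s0 s1] [M M0 hM] [rho rho0 [p p0 hp]].
have L0 : 0 < - ln s by rewrite oppr_gt0 ln_lt0// s0.
move: L0; set L := - ln s => L0.
have ln20 : 0 < ln 2 :> R by rewrite ln_gt0// ltr1n.
(* [4 * L] pays for the two levels between the covering at [k] and the bound [n < 2 ^ k.+2]. *)
exists (4 * L + `|ln (M ^+ 2)| + `|ln (rho ^+ 2 * p)|) => n n2.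
(* With this [k], the [2 * 2 ^ k] covering points of level [k] are available among [n], while
   spreading at level [k.+1] handles up to [2 ^ k.+2] points. *)
have [k /andP[kn nk]] : exists k, (2 ^ k.+1 <= n < 2 ^ k.+2)%N.
  have n0 : (0 < n)%N by exact: leq_trans n2.
  have := @trunc_log_bounds 2 n isT n0.
  have : (0 < trunc_log 2 n)%N by rewrite trunc_log_gt0.
  by case: (trunc_log 2 n) => // k _ ?; exists k.
have s2k j : 0 < s ^+ j by rewrite exprn_gt0.
have /andP[lo hi] : (s ^+ k.+1 * rho) ^+ 2 * p <= quantization_error Q n <=
    (s ^+ k * M) ^+ 2.
  apply: quantization_error_bounds => [al aln|].
    apply: distortion_ge; first by rewrite mulr_ge0// ltW.
    by apply: hp; apply: (leq_trans aln); exact: ltnW.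
  have [al /andP[al0 alk] h] := hM k; exists al; last exact: distortion_le.
  by rewrite al0 (leq_trans alk)// -expnS.
have lo0 : 0 < (s ^+ k.+1 * rho) ^+ 2 * p by rewrite mulr_gt0// exprn_gt0// mulr_gt0.
have V0 := lt_le_trans lo0 lo.
have hi0 := lt_le_trans V0 hi.
have lnlo : ln ((s ^+ k.+1 * rho) ^+ 2 * p) <= ln (quantization_error Q n).
  by rewrite ler_ln ?posrE.
have lnhi : ln (quantization_error Q n) <= ln ((s ^+ k * M) ^+ 2).
  by rewrite ler_ln ?posrE.
have lnE j z : 0 < z -> ln ((s ^+ j) ^+ 2 * z) = - (2 * j%:R * L) + ln z.
  move=> z0; rewrite lnM ?posrE ?exprn_gt0// -exprM lnXn// -[_ *+ _]mulr_natr.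
  by rewrite natrM /L; ring.
move: lnlo lnhi.
rewrite !exprMn -[_ * p]mulrA !lnE ?mulr_gt0 ?exprn_gt0//.
move=> lnlo lnhi.
have n0 : 0 < n%:R :> R by rewrite ltr0n (leq_trans _ n2).
have lnn1 : k.+1%:R * ln 2 <= ln n%:R :> R.
  by rewrite mulr_natl -lnXn ?ltr0n// ler_ln ?posrE ?exprn_gt0// -natrX ler_nat.
have lnn2 : ln n%:R <= k.+2%:R * ln 2 :> R.
  rewrite mulr_natl -lnXn ?ltr0n// ler_ln ?posrE ?exprn_gt0// -natrX ler_nat.
  exact: ltnW.
have A1 : 2 * k.+1%:R * L <= 2 * L / ln 2 * ln n%:R.
  rewrite (_ : 2 * k.+1%:R * L = 2 * L / ln 2 * (k.+1%:R * ln 2)); last first.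
    by field; rewrite gt_eqF.
  by rewrite ler_wpM2l// divr_ge0 ?mulr_ge0 ?ltW.
have A2 : 2 * L / ln 2 * ln n%:R <= 2 * k.+2%:R * L.
  rewrite (_ : 2 * k.+2%:R * L = 2 * L / ln 2 * (k.+2%:R * ln 2)); last first.
    by field; rewrite gt_eqF.
  by rewrite ler_wpM2l// divr_ge0 ?mulr_ge0 ?ltW.
have B1 := ler_norm (ln (M ^+ 2)).
have B2 := ler_norm (- ln (rho ^+ 2 * p)); rewrite normrN in B2.
have B3 := normr_ge0 (ln (M ^+ 2)).
have B4 := normr_ge0 (ln (rho ^+ 2 * p)).
move: A1 A2 lnlo lnhi; rewrite -[k.+2%:R]natr1 -![k.+1%:R]natr1.
move: (k%:R : R) => kR A1 A2 lnlo lnhi.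
rewrite ler_norml; apply/andP; split; lra.
Qed.

Lemma quantization_ratio_cvg Q s : 0 < s < 1 -> covers 2 Q s -> spreads Q s ->
  quantization_ratio Q @ \oo --> ln 2 / - ln s.
Proof.
move=> s01 hc hs.
have [B hB] := ln_quantization_error_approx s01 hc hs.
have L0 : 0 < - ln s by rewrite oppr_gt0 ln_lt0.
have ln20 : 0 < ln 2 :> R by rewrite ln_gt0// ltr1n.
(* The reciprocal ratio is treated first: dividing the bounded error by [ln n%:R] makes it
   vanish. *)
pose f n := - ln (quantization_error Q n) / ln n%:R.
have cf : f @ \oo --> 2 * - ln s / ln 2.
  apply/cvgrPdist_le => e e0.
  have h1 := near_ln_ge (B / e); have h2 := near_ln_ge 1; have h3 := nbhs_infty_ge 2.
  near=> n.
  have lnn1 : 1 <= ln n%:R :> R by near: n.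
  have lnn0 : 0 < ln n%:R :> R by exact: lt_le_trans lnn1.
  rewrite distrC /f -(ler_pM2r lnn0) -[X in _ * X <= _](gtr0_norm lnn0) -normrM.
  rewrite mulrBl divfK ?gt_eqF//.
  apply: (@le_trans _ _ B); first by apply: hB; near: n.
  by rewrite mulrC -ler_pdivrMr//; near: n.
(* Holds for every [n], also where [ln n%:R] is 0, since the inverse of 0 is 0. *)
have -> : quantization_ratio Q = (fun n => 2 * (f n)^-1).
  by apply/funext => n; rewrite /f invf_div mulrA.
have -> : ln 2 / - ln s = 2 * (2 * - ln s / ln 2)^-1.
  have lns_neq0 : ln s != 0 by rewrite -oppr_eq0 gt_eqF.
  by field; rewrite lns_neq0 gt_eqF.
apply: cvgM; first exact: cvg_cst.
by apply: cvgV => //; rewrite gt_eqF// divr_gt0// mulr_gt0.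
Unshelve. all: by end_near.
Qed.

End dimension.

(** * The two Cantor distributions and their mixture *)

Unset Implicit Arguments.
Set Strict Implicit.

Theorem theorem6p17p1 (R : realType)
    (P1 P2 P : probability (measurableTypeR R) R)
    (hP1 : is_self_similar P1 (fun x : R => 3^-1 * x)
                              (fun x : R => 3^-1 * x + 2 / 9))
    (hP2 : is_self_similar P2 (fun x : R => 4^-1 * x + 2^-1)
                              (fun x : R => 4^-1 * x + 3 / 4))
    (hP : is_half_mixture P P1 P2) :
  [/\ has_quantization_dim P1, has_quantization_dim P2,
      has_quantization_dim P &
      quantization_dim P =
        Num.max (quantization_dim P1) (quantization_dim P2)].
Proof.
have hP1' : is_self_similar P1 (affine 3^-1 0) (affine 3^-1 (2 / 9)).
  rewrite (_ : affine 3^-1 0 = fun x : R => 3^-1 * x)//.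
  by apply/funext => x; rewrite /affine addr0.
have [||c1 s1] := self_similar_covers_spreads hP1'; [lra..|].
have [||c2 s2] := self_similar_covers_spreads (s := 4^-1) hP2; [lra..|].
have cv1 : quantization_ratio P1 @ \oo --> ln 2 / - ln (3^-1 : R).
  apply: quantization_ratio_cvg => //; first by lra.
  by apply: covers_mono c1 => //; lra.
have cv2 : quantization_ratio P2 @ \oo --> ln 2 / - ln (4^-1 : R).
  apply: quantization_ratio_cvg => //; first by lra.
  by apply: covers_mono c2 => //; lra.
(* Covering uses both components, the second enlarged from ratio 1/4 to 1/3; spreading comes from
   [P1] alone. *)
have cv : quantization_ratio P @ \oo --> ln 2 / - ln (3^-1 : R).
  apply: quantization_ratio_cvg; first by lra.
    rewrite -[2%N]/(2 * 1)%N; apply: (covers_half_mixture hP _ c1); first by lra.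
    by apply: covers_mono c2 => //; lra.
  exact: (spreads_half_mixture hP s1).
split.
- by apply/cvg_ex; eexists; exact: cv1.
- by apply/cvg_ex; eexists; exact: cv2.
- by apply/cvg_ex; eexists; exact: cv.
rewrite /quantization_dim (cvg_lim _ cv)// (cvg_lim _ cv1)// (cvg_lim _ cv2)//.
(* The maximum is attained by [P1], because [ln 3 <= ln 4]. *)
apply/esym/max_idPl.
have ln20 : 0 < ln 2 :> R by rewrite ln_gt0// ltr1n.
have ln30 : 0 < ln 3 :> R by rewrite ln_gt0// ltr1n.
have ln34 : ln 3 <= ln 4 :> R by rewrite ler_ln ?posrE// ler_nat.
rewrite !lnV ?posrE// !opprK ler_pM2l// lef_pV2 ?posrE//.
exact: lt_le_trans ln34.
Qed.
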